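(* Let $X$ be a compact metric space, let $H\subset C(X)$ be a vector subspace which is total outside its zeros, and let $\mathcal{F}$ be a cone of upper semicontinuous functions on $X$ which is $H$-admissible. Let $\mu$ be a positive Radon measure supported on $X$ and assume that there exists $C_\mu>0$ such that for each $h\in H$ there exists $u\in\mathcal{F}$ with $u\le h$ and $$\int u\,d\mu\ge -C_\mu|h|_\infty .$$ Then for each non-decreasing sequence $h_i\in H$, with pointwise limit $h_i\nearrow h_\infty$, we have $S_\mu(h_\infty)=I_\mu(h_\infty)$.
   Context: $C(X)$ is the space of real-valued continuous functions on $X$, $|\cdot|_\infty$ is the sup norm. Upper semicontinuous functions may take the value $-\infty$. A cone of functions is a set closed under addition and multiplication by positive scalars. For a vector space $H\subset C(X)$, let $Z_H=\{x\in X : h(x)=0 \text{ for all } h\in H\}$ and let $E:C_c(X\setminus Z_H)\to C(X)$ denote extension by zero. $H$ is total outside its zeros if for each $\varphi\in E(C_c(X\setminus Z_H))$ there exists a decreasing sequence $h_i\in H$ with $h_i\searrow\varphi$ pointwise. $\mathcal{F}$ is $H$-admissible if each element of $H$ has a minorant in $\mathcal{F}$, and for each $u\in\mathcal{F}$ there exists a decreasing sequence $h_i\in H$ with $h_i\searrow u$ pointwise. For positive Radon measures $\nu,\mu$ supported on $X$, write $\nu\le_{\mathcal{F}}\mu$ if $\int u\,d\mu\le\int u\,d\nu$ for all $u\in\mathcal{F}$. Define $$I_\mu g=\inf\Big\{\int g\,d\nu : \nu\le_{\mathcal{F}}\mu\Big\},\qquad S_\mu g=\sup\Big\{\int u\,d\mu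 : u\in\mathcal{F},\ u\le g\Big\}.$$ *)

(* Defs.v *)
From HB Require Import structures.
From mathcomp Require Import all_boot all_order all_algebra.
From mathcomp Require Import all_classical all_reals all_analysis.

Set Implicit Arguments.
Unset Strict Implicit.
Unset Printing Implicit Defensive.

Import Order.TTheory GRing.Theory Num.Theory.
Import numFieldNormedType.Exports.

Local Open Scope classical_set_scope.
Local Open Scope ring_scope.

(* Nonempty metric spaces: a measurable type in MathComp-Analysis is pointed,
   so a metric space has to be pointed to carry a Borel measure. *)
#[short(type="pmetricType")]
HB.structure Definition PointedMetric (K : numDomainType) :=
  {M of Pointed M & Metric K M}.

Notation borelType X := (g_sigma_algebraType (@open X)).

Section potential.
Context {R : realType} {X : pmetricType R}.

Local Notation borel_measure := {measure set (borelType X) -> \bar R}.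

Definition radon (mu : borel_measure) : Prop :=
  (forall K : set X, compact K -> (mu K < +oo)%E) /\
  (forall A : set (borelType X), measurable A ->
     mu A = ereal_sup [set mu K | K in [set K : set X | compact K /\ K `<=` A]]).

Definition upper_semicontinuous (f : X -> \bar R) : Prop :=
  forall x a, (f x < a%:E)%E ->
    exists2 V, nbhs x V & forall y, V y -> (f y < a%:E)%E.

(* Upper semicontinuous functions with values in [-oo, +oo[. *)
Definition usc : set (X -> \bar R) :=
  [set u | upper_semicontinuous u /\ forall x, (u x < +oo)%E].

Definition sup_norm (h : X -> R) : R := sup (range (fun x => `|h x|)).

Definition Cc (Y : topologicalType) : set (Y -> R) :=
  [set f | continuous f /\ compact (closure [set y | f y != 0])].

Definition zeros (H : set (X -> R)) : set X :=
  [set x | forall h, H h -> h x = 0].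

(* ['valL_0 f] is the extension by zero of [f : ~` zeros H -> R]. *)
Definition extCc (H : set (X -> R)) : set (X -> R) :=
  [set 'valL_(0 : R) f | f in @Cc (set_type (~` zeros H))].

(* The sequence may be constant at some points: it is nonincreasing. *)
Definition decreases_to (h : nat -> X -> R) (g : X -> \bar R) : Prop :=
  forall x, nonincreasing_seq (fun i => h i x) /\
            (h i x)%:E @[i --> \oo] --> g x.

Definition increases_to (h : nat -> X -> R) (g : X -> \bar R) : Prop :=
  forall x, nondecreasing_seq (fun i => h i x) /\
            (h i x)%:E @[i --> \oo] --> g x.

Definition total_outside_zeros (H : set (X -> R)) : Prop :=
  forall phi, extCc H phi ->
    exists h : nat -> X -> R,
      (forall i, H (h i)) /\ decreases_to h (EFin \o phi).

Definition cone (F : set (X -> \bar R)) : Prop :=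
  (forall u v, F u -> F v -> F (u \+ v)%E) /\
  (forall (c : R) u, 0 < c -> F u -> F (fun x => c%:E * u x)%E).

Definition admissible (H : set (X -> R)) (F : set (X -> \bar R)) : Prop :=
  (forall h, H h -> exists2 u, F u & forall x, (u x <= (h x)%:E)%E) /\
  (forall u, F u -> exists h : nat -> X -> R,
      (forall i, H (h i)) /\ decreases_to h u).

(* [measure_le F nu mu] is the relation nu <=_F mu; note that the integrals
   are compared in the opposite direction. *)
Definition measure_le (F : set (X -> \bar R)) (nu mu : borel_measure) : Prop :=
  forall u, F u -> (\int[mu]_x u x <= \int[nu]_x u x)%E.

Definition Imu (F : set (X -> \bar R)) (mu : borel_measure) (g : X -> \bar R) :
    \bar R :=
  ereal_inf [set (\int[nu]_x g x)%E |
    nu in [set nu : borel_measure | radon nu /\ measure_le F nu mu]].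

Definition Smu (F : set (X -> \bar R)) (mu : borel_measure) (g : X -> \bar R) :
    \bar R :=
  ereal_sup [set (\int[mu]_x u x)%E |
    u in [set u | F u /\ forall x, (u x <= g x)%E]].

End potential.

(* Main.v *)
(* The inequality [Smu <= Imu] is integration of [u <= hlim].  For the converse let
   [s = Smu hlim], finite.  If [nu] is a measure with [nu <=_F mu] then [L = int _ dnu]
   is positive, [L k >= Smu k] for [k] in [H], and it proves [Imu hlim <= s] as soon as
   [L (h j) <= s] for all [j].  The upper bounds on [L f] forced by these conditions
   have a sublinear infimum, because [h] is nondecreasing and [Smu] superadditive, so
   Hahn-Banach gives a linear [L] on the bounded functions that satisfies all of them
   at once, and no compactness argument on a sequence of measures is needed.  The
   infimum is finite thanks to the one-sided bound [Smu k >= - C * sup k^-]: as [H] is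
   total outside its zeros, [k^+] and [k^-] are uniform limits of elements of [H] (Dini).
   Since [L] is defined on indicator functions, [A |-> L \1_A] is a finitely additive
   content, from which the Riesz measure is built. *)
From HB Require Import structures.
Require Import Defs.
From mathcomp Require Import all_boot all_order all_algebra.
From mathcomp Require Import all_classical all_reals all_analysis.
From mathcomp Require Import measurable_realfun ring lra.

Set Implicit Arguments.
Unset Strict Implicit.
Unset Printing Implicit Defensive.

Import Order.TTheory GRing.Theory Num.Theory.
Import numFieldNormedType.Exports.

Local Open Scope classical_set_scope.
Local Open Scope ring_scope.

(** * Hahn-Banach for a sublinear functional on a subspace [D] *)

Section hahn_banach.
Context {R : realType} {V : lmodType R}.
Variable D : set V.
Hypothesis D_lin : forall (a : R) x y, D x -> D y -> D (a *: x + y).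
Hypothesis D0 : D 0.

(** Relative to [D] because the functional used later is an infimum controlled on bounded functions
    only. Homogeneity is asked as an inequality, which is what infima give directly; [sublinear_onZ]
    recovers equality. *)
Definition sublinear_on (q : V -> R) : Prop :=
  (forall x y, D x -> D y -> q (x + y) <= q x + q y) /\
  (forall c x, 0 <= c -> D x -> q (c *: x) <= c * q x).

Let DZ (a : R) x : D x -> D (a *: x).
Proof. by move=> Dx; rewrite -[_ *: _]addr0; exact: D_lin. Qed.

Let DD x y : D x -> D y -> D (x + y).
Proof. by move=> Dx Dy; rewrite -[x]scale1r; exact: D_lin. Qed.

Let DN x : D x -> D (- x).
Proof. by rewrite -scaleN1r; exact: DZ. Qed.

Lemma sublinear_on0 q : sublinear_on q -> q 0 = 0.
Proof.
move=> [qD qZ]; apply/eqP; rewrite eq_le; apply/andP; split.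
  by rewrite -(scale0r 0) (le_trans (qZ _ _ _ _))// mul0r.
by have := qD 0 0 D0 D0; rewrite addr0; lra.
Qed.

Lemma sublinear_onZ q c x : sublinear_on q -> 0 <= c -> D x ->
  q (c *: x) = c * q x.
Proof.
move=> sq; rewrite le_eqVlt => /predU1P[<- _|c0 Dx].
  by rewrite scale0r mul0r sublinear_on0.
apply/eqP; rewrite eq_le sq.2 ?(ltW c0)//= -ler_pdivlMl//.
have := sq.2 c^-1 (c *: x) _ (DZ c Dx).
by rewrite scalerA mulVf ?gt_eqF// scale1r; apply; rewrite invr_ge0 ltW.
Qed.

Lemma sublinear_onN q x : sublinear_on q -> D x -> - q (- x) <= q x.
Proof.
by move=> sq Dx; have := sq.1 _ _ Dx (DN Dx); rewrite subrr sublinear_on0//; lra.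
Qed.

Variable p : V -> R.
Hypothesis sp : sublinear_on p.

Let T := {q | sublinear_on q /\ forall x, D x -> q x <= p x}.

(** The order is reversed, so that a maximal element for Zorn's lemma is a minimal functional. *)
Let below (q1 q2 : T) := `[< forall x, D x -> projT1 q2 x <= projT1 q1 x >].

(** The pointwise infimum of the chain works: it is finite because every member is at least
    [- p (- x)] at [x], and subadditive because, of two members of the chain, the smaller one serves
    at both points. *)
Let below_chain (A : set T) : total_on A below ->
  exists t, forall q, A q -> below q t.
Proof.
move=> totA; have [[q0 Aq0]|A0] := pselect (A !=set0); last first.
  by exists (exist _ p (conj sp (fun x _ => lexx (p x)))) => q Aq; case: A0; exists q.
pose t x := inf [set projT1 q x | q in A].
have lb x : D x -> has_lbound [set projT1 q x | q in A].
  move=> Dx; exists (- p (- x)) => _ [q Aq] <-; have [sq qp] := projT2 q.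
  by rewrite (le_trans _ (sublinear_onN sq Dx))// lerN2; apply: qp; exact: DN.
have tq q x : A q -> D x -> t x <= projT1 q x.
  by move=> Aq Dx; apply: ge_inf; [exact: lb|exists q].
have tge x y : (forall q, A q -> y <= projT1 q x) -> y <= t x.
  move=> yq; apply: lb_le_inf; first by exists (projT1 q0 x); exists q0.
  by move=> _ [q Aq <-]; exact: yq.
have st : sublinear_on t.
  split=> [x y Dx Dy|c x].
    rewrite -lerBlDr; apply: (tge) => q1 Aq1; rewrite lerBlDr [leRHS]addrC -lerBlDr.
    apply: (tge) => q2 Aq2; rewrite lerBlDr.
    have [q [Aq q1q q2q]] :
        exists q, [/\ A q, projT1 q x <= projT1 q1 x & projT1 q y <= projT1 q2 y].
      have [/asboolP q12|/asboolP q21] := totA _ _ Aq1 Aq2.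
        by exists q2; split => //; exact: q12.
      by exists q1; split => //; exact: q21.
    rewrite [leRHS]addrC (le_trans (tq q _ Aq _))//; first exact: DD.
    rewrite (le_trans ((projT2 q).1.1 _ _ Dx Dy))//.
    by rewrite lerD.
  rewrite le_eqVlt => /predU1P[<- Dx|c0 Dx].
    rewrite scale0r mul0r (le_trans (tq q0 _ _ _))//.
    by rewrite (sublinear_on0 (projT2 q0).1).
  rewrite mulrC -ler_pdivrMr//; apply: (tge) => q Aq; rewrite ler_pdivrMr// mulrC.
  rewrite (le_trans (tq q _ Aq _)) ?(projT2 q).1.2 ?(ltW c0)//; exact: DZ.
have tp x : D x -> t x <= p x.
  by move=> Dx; rewrite (le_trans (tq q0 _ _ _))//; exact: (projT2 q0).2.
by exists (exist _ t (conj st tp)) => q Aq; apply/asboolP => x; exact: tq.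
Qed.

(* A minimal sublinear functional is linear. *)
Lemma hahn_banach : exists L : V -> R,
  (forall a x y, D x -> D y -> L (a *: x + y) = a * L x + L y) /\
  (forall x, D x -> L x <= p x).
Proof.
have [] := @ZL_preorder T (exist _ p (conj sp (fun x _ => lexx (p x)))) below _ _
  below_chain.
- by move=> q; apply/asboolP.
- move=> q r s /asboolP rq /asboolP qs; apply/asboolP => x Dx.
  by rewrite (le_trans (qs _ Dx)) ?rq.
move=> [q [sq qp]] minq.
have superq x y : D x -> D y -> q x + q y <= q (x + y).
  move=> Dx Dy.
  (* [inf (A z)] is again sublinear and below [q], so minimality of [q] gives [q <= inf (A z)]; the
     term [t = 1] then yields superadditivity. *)
  pose A z := [set q (z + t *: y) - t * q y | t in [set t | 0 <= t]].
  have lb z : D z -> has_lbound (A z).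
    move=> Dz; exists (- q (- z)) => _ [t /= t0 <-].
    have := sq.1 _ _ (DD Dz (DZ t Dy)) (DN Dz).
    by rewrite [z + _]addrC addrK sublinear_onZ//; lra.
  have Age z r : (forall t, 0 <= t -> r <= q (z + t *: y) - t * q y) ->
      r <= inf (A z).
    move=> rA; apply: lb_le_inf; first by exists (q (z + 0 *: y) - 0 * q y); exists 0 => /=.
    by move=> _ [t /= t0 <-]; exact: rA.
  have Ale z t : D z -> 0 <= t -> inf (A z) <= q (z + t *: y) - t * q y.
    by move=> Dz t0; apply: ge_inf; [exact: lb|exists t].
  have sA : sublinear_on (fun z => inf (A z)).
    split=> [a b Da Db|c a].
      rewrite -lerBlDr; apply: (Age) => s s0; rewrite lerBlDr [leRHS]addrC -lerBlDr.
      apply: (Age) => t t0; rewrite lerBlDr.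
      rewrite (le_trans (Ale _ (s + t) (DD Da Db) _)) ?addr_ge0//.
      have := sq.1 _ _ (DD Da (DZ s Dy)) (DD Db (DZ t Dy)).
      by rewrite addrACA -scalerDl; lra.
    rewrite le_eqVlt => /predU1P[<- Da|c0 Da].
      rewrite scale0r mul0r (le_trans (Ale _ 0 _ _))//.
      by rewrite scale0r addr0 mul0r sublinear_on0 ?subrr.
    rewrite mulrC -ler_pdivrMr//; apply: (Age) => t t0; rewrite ler_pdivrMr// mulrC.
    rewrite (le_trans (Ale _ (c * t) (DZ _ Da) _)) ?mulr_ge0 ?(ltW c0)//.
    by rewrite -scalerA -scalerDr sublinear_onZ ?(ltW c0)//; [rewrite mulrBr mulrA|exact/DD/DZ].
  have Aq z : D z -> inf (A z) <= q z.
    by move=> Dz; rewrite (le_trans (Ale _ 0 _ _))// scale0r addr0 mul0r subr0.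
  have Ap z : D z -> inf (A z) <= p z.
    by move=> Dz; rewrite (le_trans (Aq _ Dz)) ?qp.
  have /asboolP/(_ x Dx)/= qA : below (exist _ _ (conj sA Ap)) (exist _ _ (conj sq qp)).
    by apply: minq; apply/asboolP => z /=; exact: Aq.
  by rewrite -lerBrDr (le_trans qA)// (le_trans (Ale _ 1 _ _))// scale1r mul1r.
have qD x y : D x -> D y -> q (x + y) = q x + q y.
  by move=> Dx Dy; apply/eqP; rewrite eq_le sq.1 ?superq.
exists q; split=> // a x y Dx Dy; rewrite qD//; last exact: DZ.
congr +%R; have [a0|a0] := leP 0 a; first exact: sublinear_onZ.
(* For [a < 0], additivity on [a *: x] and [- a *: x] reduces to the positive factor [- a]. *)
have := qD _ _ (DZ a Dx) (DZ (- a) Dx).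
rewrite -scalerDl subrr scale0r sublinear_on0// (sublinear_onZ (c := - a))//; last lra.
lra.
Qed.

End hahn_banach.

(** * From a finitely additive content to a regular Borel measure *)

Section content_measure.
Context {R : realType} {X : ptopologicalType}.
Hypothesis compactX : compact [set: X].
Hypothesis hausdorffX : hausdorff_space X.
Variable m : set X -> R.
Hypothesis m_le : forall A B, A `<=` B -> m A <= m B.
Hypothesis mU : forall A B, A `&` B = set0 -> m (A `|` B) = m A + m B.

Local Open Scope ereal_scope.

Let m0 : m set0 = 0%R.
Proof. by have := mU (set0I set0); rewrite setU0; lra. Qed.

(** Closed sets are the compact ones here, so this is the usual inner measure of an open set;
    [outer_content] extends it to all sets by outer regularity. *)
Definition inner_content (U : set X) : \bar R :=
  ereal_sup [set (m K)%:E | K in [set K | closed K /\ K `<=` U]].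

Definition outer_content (A : set X) : \bar R :=
  ereal_inf [set inner_content U | U in [set U | open U /\ A `<=` U]].

Lemma content_le_inner K U : closed K -> K `<=` U -> (m K)%:E <= inner_content U.
Proof. by move=> cK KU; apply: ereal_sup_ubound; exists K. Qed.

Lemma inner_content_ge0 U : 0 <= inner_content U.
Proof.
have -> : 0 = (m set0)%:E by rewrite m0.
by apply: content_le_inner => //; exact: closed0.
Qed.

Lemma inner_content_le_content U : inner_content U <= (m U)%:E.
Proof. by apply: ge_ereal_sup => _ [K [cK KU] <-]; rewrite lee_fin m_le. Qed.

Lemma le_inner_content U W : U `<=` W -> inner_content U <= inner_content W.
Proof.
move=> UW; apply: ge_ereal_sup => _ [K [cK KU] <-]; apply: content_le_inner => //.
exact: subset_trans UW.
Qed.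

(** Normality separates the parts of [K] outside [U] and outside [W] by disjoint open sets [U'] and
    [W']. Removing [U'], respectively [W'], from [K] leaves closed pieces inside [U] and [W] that
    together cover [K]. *)
Lemma inner_contentU U W : open U -> open W ->
  inner_content (U `|` W) <= inner_content U + inner_content W.
Proof.
move=> oU oW; apply: ge_ereal_sup => _ [K [cK KUW] <-].
have [|||U' [W' [oU' oW' KU' KW' UW']]] :=
    (@normal_openP R X).1 (compact_normal hausdorffX compactX) (K `\` U) (K `\` W).
- by apply: closedI => //; exact: open_closedC.
- by apply: closedI => //; exact: open_closedC.
- by rewrite -subset0 => x [[Kx nUx] [_ nWx]]; have [] := KUW x Kx.
have cKU' : closed (K `\` U') by apply: closedI => //; exact: open_closedC.
have cKW' : closed (K `\` W') by apply: closedI => //; exact: open_closedC.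
apply: (@le_trans _ _ ((m (K `\` U'))%:E + (m (K `\` W'))%:E)).
  rewrite -EFinD lee_fin.
  have -> : m K = (m (K `\` U') + m (K `&` U'))%R.
    rewrite -mU; last by rewrite -subset0 => x [[_ nU'x] [_ /nU'x]].
    congr m; apply/seteqP; split=> x; last by move=> [[]|[]].
    by move=> Kx; have [] := pselect (U' x); [right|left].
  rewrite lerD2l m_le// => x [Kx U'x]; split => //.
  by move=> W'x; suff : set0 x by []; rewrite -UW'.
apply: leeD; apply: content_le_inner => // x [Kx nx].
- by apply: contrapT => nUx; apply: nx; exact: KU'.
- by apply: contrapT => nUx; apply: nx; exact: KW'.
Qed.

Lemma inner_content_bigsetU (U : nat -> set X) n : (forall i, open (U i)) ->
  inner_content (\big[setU/set0]_(i < n) U i) <= \sum_(i < n) inner_content (U i).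
Proof.
move=> oU; elim: n => [|n ih].
  by rewrite !big_ord0 (le_trans (inner_content_le_content _))// m0.
rewrite !big_ord_recr/= (le_trans (inner_contentU _ _))// ?leeD2r//.
by rewrite -bigcup_mkord; apply: bigcup_open.
Qed.

Lemma inner_content_bigcup (U : nat -> set X) : (forall i, open (U i)) ->
  inner_content (\bigcup_i U i) <= \sum_(i <oo) inner_content (U i).
Proof.
move=> oU; apply: ge_ereal_sup => _ [K [cK KU] <-].
have : compact K by rewrite -(setTI K); exact: compact_closedI.
rewrite compact_cover => /(_ nat setT U (fun i _ => oU i) KU)[D' _ KD'].
pose N := (\max_(i <- finmap.enum_fset D') i).+1%N.
have KN : K `<=` \big[setU/set0]_(i < N) U i.
  move=> x /KD'[i /= iD' Uix]; rewrite -bigcup_mkord; exists i => //=.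
  by rewrite ltnS; exact: leq_bigmax_seq.
rewrite (le_trans (content_le_inner cK KN))//.
rewrite (le_trans (inner_content_bigsetU _ oU))//.
rewrite -(big_mkord xpredT (fun i => inner_content (U i))).
by apply: nneseries_lim_ge => i _ _; exact: inner_content_ge0.
Qed.

Lemma outer_content_open U : open U -> outer_content U = inner_content U.
Proof.
move=> oU; apply/eqP; rewrite eq_le; apply/andP; split.
  by apply: ereal_inf_lbound; exists U => //; split.
by apply: le_ereal_inf_tmp => _ [W [oW UW] <-]; exact: le_inner_content.
Qed.

Lemma outer_content_ge0 A : 0 <= outer_content A.
Proof. by apply: le_ereal_inf_tmp => _ [W [oW UW] <-]; exact: inner_content_ge0. Qed.

Lemma content_le_outer K : closed K -> (m K)%:E <= outer_content K.
Proof.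
by move=> cK; apply: le_ereal_inf_tmp => _ [W [oW KW] <-]; exact: content_le_inner.
Qed.

Lemma le_outer_content A B : A `<=` B -> outer_content A <= outer_content B.
Proof.
move=> AB; apply: ereal_inf_le_tmp => _ [W [oW BW] <-]; exists W => //; split => //.
exact: subset_trans BW.
Qed.

Lemma outer_contentT : outer_content setT = (m setT)%:E.
Proof.
apply/eqP; rewrite eq_le content_le_outer ?andbT; last exact: closedT.
by rewrite outer_content_open ?inner_content_le_content//; exact: openT.
Qed.

Lemma outer_content_fin_num A : outer_content A \is a fin_num.
Proof.
rewrite ge0_fin_numE ?outer_content_ge0//.
by rewrite (le_lt_trans (le_outer_content (@subsetT _ A)))// outer_contentT ltry.
Qed.

Lemma outer_content_approx A (e : R) : (0 < e)%R ->
  exists U, [/\ open U, A `<=` U & inner_content U <= outer_content A + e%:E].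
Proof.
move=> e0; have [_ [U [oU AU] <-] /ltW Ue] :=
  lb_ereal_inf_adherent e0 (outer_content_fin_num A).
by exists U.
Qed.

Lemma outer_content_sigma_subadditive : sigma_subadditive outer_content.
Proof.
move=> A; apply/lee_addgt0Pr => e e0.
have /choice[U AU] : forall i, exists U, [/\ open U, A i `<=` U &
    inner_content U <= outer_content (A i) + (e / (2 ^ i.+1)%:R)%:E].
  by move=> i; apply: outer_content_approx; rewrite divr_gt0.
rewrite (le_trans _ (epsilon_trick xpredT _ (ltW e0)))//; last first.
  by move=> i; exact: outer_content_ge0.
apply: (@le_trans _ _ (\sum_(i <oo) inner_content (U i))); last first.
  by apply: lee_nneseries => i *; [exact: inner_content_ge0|have [] := AU i].
rewrite (le_trans _ (inner_content_bigcup _))//; last by move=> i; have [] := AU i.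
apply: ereal_inf_lbound; exists (\bigcup_i U i) => //; split.
  by apply: bigcup_open => i _; have [] := AU i.
by apply: subset_bigcup => i _; have [] := AU i.
Qed.

Lemma outer_content0 : outer_content set0 = 0.
Proof.
apply/eqP; rewrite eq_le outer_content_ge0 andbT outer_content_open; last exact: open0.
by rewrite (le_trans (inner_content_le_content _))// m0.
Qed.

HB.instance Definition _ := isOuterMeasure.Build R X outer_content
  outer_content0 outer_content_ge0 le_outer_content
  outer_content_sigma_subadditive.

(** It suffices to split open sets [W]. Approximate the part of [W] in [U] by a closed [K], then
    what remains of [W] by a closed [K']: they are disjoint, so their contents add up to at most
    that of [W], and the part of [W] outside [U] avoids [K]. *)
Lemma open_caratheodory U : open U -> outer_content.-caratheodory U.
Proof.
move=> oU; apply: le_caratheodory_measurable => A.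
apply: le_ereal_inf_tmp => _ [W [oW AW] <-].
have : outer_content (W `&` U) + outer_content (W `&` ~` U) <= inner_content W.
  rewrite outer_content_open; last exact: openI.
  have fW : inner_content (W `&` U) \is a fin_num.
    by rewrite -outer_content_open ?outer_content_fin_num//; exact: openI.
  rewrite -leeBrDr ?outer_content_fin_num//.
  apply: ge_ereal_sup => _ [K [cK KWU] <-].
  rewrite leeBrDr ?outer_content_fin_num// -leeBrDl//.
  apply: (@le_trans _ _ (inner_content (W `\` K))).
    apply: ereal_inf_lbound; exists (W `\` K) => //; split.
      by apply: openI => //; exact: closed_openC.
    by move=> x [Wx nUx]; split => // /KWU[].
  apply: ge_ereal_sup => _ [K' [cK' K'WK] <-].
  rewrite leeBrDl// -EFinD -mU; last first.
    by rewrite -subset0 => x [Kx /K'WK[]].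
  apply: content_le_inner; first exact: closedU.
  by move=> x [/KWU[]|/K'WK[]].
by apply: le_trans; apply: leeD; apply: le_outer_content; exact: setSI.
Qed.

Lemma measurable_caratheodory (A : set (borelType X)) :
  measurable A -> outer_content.-caratheodory A.
Proof.
apply: smallest_sub; last exact: open_caratheodory.
split=> [|B cB|F cF].
- exact: caratheodory_measurable_set0.
- by rewrite setTD; exact: caratheodory_measurable_setC.
- exact: caratheodory_measurable_bigcup.
Qed.

Let outer_content_semi_sigma_additive :
  semi_sigma_additive (outer_content : set (borelType X) -> \bar R).
Proof.
move=> F mF tF mUF.
apply: (@caratheodory_measure_sigma_additive R X outer_content) => //.
- by move=> i; exact: measurable_caratheodory.
- exact: measurable_caratheodory.
Qed.

HB.instance Definition _ := isMeasure.Build _ (borelType X) R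
  (outer_content : set (borelType X) -> \bar R)
  outer_content0 outer_content_ge0 outer_content_semi_sigma_additive.

Lemma content_measure : exists nu : {measure set (borelType X) -> \bar R},
  [/\ nu setT = (m setT)%:E,
      forall K, closed K -> (m K)%:E <= nu K &
      forall A : set (borelType X), measurable A ->
        nu A = ereal_sup [set nu K | K in [set K : set X | closed K /\ K `<=` A]]].
Proof.
exists (outer_content : set (borelType X) -> \bar R); split.
- exact: outer_contentT.
- exact: content_le_outer.
move=> A mA; apply/eqP; rewrite eq_le; apply/andP; split; last first.
  by apply: ge_ereal_sup => _ [K [_ KA] <-]; exact: le_outer_content.
apply/lee_addgt0Pr => e e0.
(* Inner regularity of [A] is outer regularity of its complement: the complement of [U] is a closed
   subset of [A] with measure within [e]. *)
have [U [oU AU Ue]] := outer_content_approx (~` A) e0.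
have cU : closed (~` U) by exact: open_closedC.
apply: (@le_trans _ _ (outer_content (~` U) + e%:E)); last first.
  rewrite leeD2r//; apply: ereal_sup_ubound; exists (~` U) => //; split => //.
  by move=> x; apply: contra_notP; exact: AU.
have TA : (m setT)%:E = outer_content A + outer_content (~` A).
  by rewrite -outer_contentT (measurable_caratheodory mA) !setTI.
have TU : (m setT)%:E = outer_content U + outer_content (~` U).
  by rewrite -outer_contentT (open_caratheodory oU) !setTI.
move: Ue TA TU; rewrite -outer_content_open//.
rewrite -(fineK (outer_content_fin_num U)) -(fineK (outer_content_fin_num (~` U))).
rewrite -(fineK (outer_content_fin_num A)) -(fineK (outer_content_fin_num (~` A))).
rewrite -!EFinD lee_fin => Ue [TA] [TU].
rewrite -[leLHS](fineK (outer_content_fin_num A)) lee_fin; lra.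
Qed.

End content_measure.

(** * Bounded and continuous functions as Borel integrands *)

Definition ubounded {R : realType} {X : Type} (f : X -> R) : Prop :=
  exists M, forall x, `|f x| <= M.

Lemma compact_ubounded {R : realType} {X : topologicalType} (f : X -> R) :
  compact [set: X] -> continuous f -> ubounded f.
Proof.
move=> cX cf; have /compact_bounded[M [_ fM]] : compact (f @` setT).
  by apply: continuous_compact => //; exact: continuous_subspaceT.
by exists (M + 1) => x; apply: fM; rewrite ?ltrDl//; exists x.
Qed.

Lemma open_borel {X : ptopologicalType} (U : set X) :
  open U -> measurable (U : set (borelType X)).
Proof. exact: sub_gen_smallest. Qed.

Lemma closed_borel {X : ptopologicalType} (K : set X) :
  closed K -> measurable (K : set (borelType X)).
Proof.
move=> cK; rewrite -(setCK K); apply: measurableC; apply: open_borel.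
exact: closed_openC.
Qed.

Lemma continuous_borel_measurable {R : realType} {X : ptopologicalType} (f : X -> R) :
  continuous f -> measurable_fun setT (f : borelType X -> R).
Proof.
move=> /continuousP cf; apply: (measurability _ (RGenOpens.measurableE R)).
move=> _ [_ [a [b ->] <-]]; rewrite setTI; apply: open_borel.
by apply: cf; exact: interval_open.
Qed.

Lemma ubounded_integrable {d} {T : measurableType d} {R : realType}
    (nu : {measure set T -> \bar R}) (f : T -> R) :
  (nu setT < +oo)%E -> measurable_fun setT f -> ubounded f ->
  nu.-integrable setT (EFin \o f).
Proof.
move=> nuT mf [M fM]; apply: measurable_bounded_integrable => //.
by exists M; split; [exact: num_real|move=> N MN x _; exact: le_trans (ltW MN)].
Qed.

Lemma continuous_integrable {R : realType} {X : ptopologicalType}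
    (nu : {measure set (borelType X) -> \bar R}) (f : X -> R) :
  compact [set: X] -> (nu setT < +oo)%E -> continuous f ->
  nu.-integrable setT (EFin \o f).
Proof.
move=> cX nuT cf; apply: (@ubounded_integrable _ (borelType X)) => //.
  exact: continuous_borel_measurable.
exact: compact_ubounded.
Qed.

(** * Riesz representation on a compact metric space *)

Section riesz.
Context {R : realType} {X : pmetricType R}.
Hypothesis compactX : compact [set: X].
Variable L : (X -> R) -> R.
Hypothesis L_lin : forall a f g, ubounded f -> ubounded g ->
  L (fun x => a * f x + g x) = a * L f + L g.
Hypothesis L_le : forall f g, ubounded f -> ubounded g -> (forall x, f x <= g x) ->
  L f <= L g.

Let LD f g : ubounded f -> ubounded g -> L (fun x => f x + g x) = L f + L g.
Proof.
move=> bf bg; rewrite -[L f]mul1r -L_lin//; congr L.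
by apply/funext => x; rewrite mul1r.
Qed.

Let ubounded_cst (a : R) : ubounded (fun _ : X => a).
Proof. by exists `|a| => _. Qed.

Let L0 : L (fun=> 0) = 0.
Proof.
by have := LD (ubounded_cst 0) (ubounded_cst 0); under eq_fun do rewrite addr0; lra.
Qed.

Let LZ a f : ubounded f -> L (fun x => a * f x) = a * L f.
Proof.
move=> bf; rewrite -[RHS]addr0 -L0 -L_lin//; congr L.
by apply/funext => x; rewrite addr0.
Qed.

Let ubounded_indic (A : set X) : ubounded (\1_A : X -> R).
Proof. by exists 1 => x; rewrite indicE; case: (_ \in _); rewrite ?normr1 ?normr0. Qed.

(** The measure dominates [m] on closed sets and has the same total mass, which yields [L f <= I f];
    replacing [f] by [- f] yields equality. *)
Lemma riesz_compact : exists nu : {measure set (borelType X) -> \bar R},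
  [/\ radon nu, (nu setT < +oo)%E &
      forall f : X -> R, continuous f -> \int[nu]_x f x = L f].
Proof.
have hX : hausdorff_space X by exact: metric_hausdorff.
pose m (A : set X) := L \1_A.
have m_ge0 A : 0 <= m A.
  by rewrite -L0; apply: L_le => // x; rewrite indicE.
have m_le A B : A `<=` B -> m A <= m B.
  move=> AB; apply: L_le => // x; rewrite !indicE ler_nat.
  by have [/set_mem/AB/mem_set->|] := boolP (x \in A).
have mU A B : A `&` B = set0 -> m (A `|` B) = m A + m B.
  move=> AB; rewrite /m -LD//; congr L; apply/funext => x; rewrite !indicE in_setU.
  have [xA|] := boolP (x \in A); have [xB|] := boolP (x \in B);
    rewrite ?addr0 ?add0r//.
  have : (A `&` B) x by split; exact: set_mem.
  by rewrite AB.
have [nu [nuT nuK nuR]] := content_measure compactX hX m_le mU.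
have fin_nu : (nu setT < +oo)%E by rewrite nuT ltry.
have int_nu (f : X -> R) : continuous f -> nu.-integrable setT (EFin \o f).
  exact: continuous_integrable.
exists nu; split => //.
  split=> [K cK|A mA].
    rewrite (le_lt_trans _ fin_nu)// le_measure ?inE//.
    by apply: closed_borel; exact: compact_closed.
  rewrite nuR//; congr ereal_sup; apply/seteqP; split=> _ [K [cK KA] <-]; exists K => //.
    by split => //; rewrite -(setTI K); exact: compact_closedI.
  by split => //; exact: compact_closed.
pose I (f : X -> R) : R := \int[nu]_x f x.
have ID (f g : X -> R) : continuous f -> continuous g -> I (fun x => f x + g x) = I f + I g.
  by move=> cf cg; rewrite /I RintegralD//; exact: int_nu.
have LT (a : R) : L (fun=> a) = a * m setT.
  by rewrite -LZ//; congr L; apply/funext => x; rewrite indicE in_setT mulr1.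
have IC (a : R) : I (fun=> a) = a * m setT.
  by rewrite /I Rintegral_cst// nuT.
(* [L (min f d) <= d * m {f > 0}] and [d * m {f >= d} <= I (min f d)], and the
   two bounds telescope when [f] is cut into slices of height [d]. *)
have slice (n : nat) (d : R) (f : X -> R) : 0 < d -> continuous f -> (forall x, 0 <= f x <= n%:R * d) ->
    L f <= I f + d * m [set x | 0 < f x].
  move=> d0; elim: n f => [|n ih] f cf f0.
    have -> : f = (fun=> 0).
      by apply/funext => x; have := f0 x; rewrite mul0r; lra.
    by rewrite L0 IC mul0r add0r mulr_ge0 ?m_ge0 ?(ltW d0).
  (* Cut off the bottom slice of height [d]; the rest [f2] needs one slice less. *)
  pose f1 x := Num.min (f x) d; pose f2 x := Num.max (f x - d) 0.
  have fE : f = (fun x => f1 x + f2 x).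
    by apply/funext => x; rewrite /f1 /f2 /Num.min /Num.max; case: ltP => ?; case: ltP => ?; lra.
  have cf1 : continuous f1.
    move=> x; apply: (@continuous_min R X f (fun=> d)); first exact: cf.
    exact: cvg_cst.
  have cf2 : continuous f2.
    move=> x; apply: (@continuous_max R X (fun x => f x - d) (fun=> 0)).
      by apply: continuousB; [exact: cf|exact: cvg_cst].
    exact: cvg_cst.
  have f20 x : 0 <= f2 x <= n%:R * d.
    have := f0 x; rewrite /f2 mulrSr mulrDl mul1r /Num.max => f0x.
    by case: ltP => ?; apply/andP; split; rewrite ?mulr_ge0 ?(ltW d0)//; lra.
  have := ih _ cf2 f20.
  have Lf1 : L f1 <= d * m [set x | 0 < f x].
    rewrite -LZ//; apply: L_le => [||x]; [exact: compact_ubounded| |].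
      by exists d => x; rewrite indicE; case: (_ \in _);
        rewrite ?mulr1 ?mulr0 ?normr0 ?(gtr0_norm d0) ?(ltW d0).
    rewrite indicE /f1; have := f0 x; have [fx|fx] := ltP 0 (f x).
      by rewrite mem_set// mulr1 ge_min lexx orbT.
    by rewrite memNset/= ?mulr0 ?ge_min ?fx// ltNge fx.
  (* The error that the induction leaves for [f2] is absorbed by the integral of [f1], which is [d]
     on the closed set [K], and [K] contains all points where [f2] is positive. *)
  have If1 : d * m [set x | 0 < f2 x] <= I f1.
    pose K := [set x : X | d <= f x].
    have cK : closed K.
      by apply: (preimage_closed _ (@closed_ge R d)) => x _; exact: cf.
    have : d * m K <= I f1.
      have mK : measurable (K : set (borelType X)).
        exact: closed_borel.
      have fin_nuK : (nu K < +oo)%E.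
        by rewrite (le_lt_trans _ fin_nu)// le_measure ?inE.
      have int1 : nu.-integrable setT (EFin \o \1_K).
        by apply: ubounded_integrable => //; exact: measurable_indic.
      apply: (@le_trans _ _ (\int[nu]_x (d * \1_K x))).
        rewrite RintegralZl// ler_pM2l// /Rintegral integral_indic// setIT.
        by rewrite -lee_fin fineK ?ge0_fin_numE// nuK.
      apply: le_Rintegral => //; [|exact: int_nu|].
        by have := integrableZl measurableT d int1.
      move=> x _; rewrite indicE /f1; have [fx|fx] := leP d (f x).
        by rewrite mem_set// mulr1.
      rewrite memNset ?mulr0; first by case/andP: (f0 x).
      by rewrite /K/= leNgt fx.
    apply: le_trans; rewrite ler_pM2l// m_le// => x /=; rewrite /f2 lt_max ltxx orbF.
    by rewrite subr_gt0 => /ltW.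
  rewrite [in L f]fE [in I f]fE ID// LD; [lra|exact: compact_ubounded..].
have LI0 (f : X -> R) : continuous f -> (forall x, 0 <= f x) -> L f <= I f.
  move=> cf f0; apply/ler_addgt0Pr => e e0.
  have [M fM] := compact_ubounded compactX cf.
  (* Makes the error [d * m setT] at most [e]; the [+ 1] covers [m setT = 0]. *)
  pose d := e / (m setT + 1).
  have mT0 : 0 < m setT + 1 by rewrite ltr_wpDl.
  have d0 : 0 < d by rewrite divr_gt0.
  have := @slice (Num.trunc (M / d)).+1 d f d0 cf _.
  have fn x : 0 <= f x <= (Num.trunc (M / d)).+1%:R * d.
    rewrite f0/= -ler_pdivrMr// (le_trans _ (ltW (truncnS_gt _)))//.
    by rewrite ler_pM2r ?invr_gt0// (le_trans (ler_norm _)).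
  move=> /(_ fn)/le_trans; apply; rewrite lerD2l.
  rewrite (le_trans (ler_wpM2l (ltW d0) (m_le _ _ (@subsetT _ _))))//.
  by rewrite /d mulrAC ler_pdivrMr// ler_pM2l//; lra.
have LI (f : X -> R) : continuous f -> L f <= I f.
  move=> cf; have [M fM] := compact_ubounded compactX cf.
  have cM : continuous (fun _ : X => M) by move=> x; exact: cvg_cst.
  (* Shifting by [M] gives a nonnegative function; [L] and [I] agree on constants because the total
     masses do. *)
  have := LI0 (fun x => f x + M).
  rewrite ID// (LD (compact_ubounded compactX cf) (ubounded_cst M)) LT IC lerD2r.
  apply => x; last by have := fM x; rewrite ler_norml; lra.
  by apply: continuousD; [exact: cf|exact: cM].
move=> f cf; apply/eqP; rewrite eq_le LI// andbT.
have cNf : continuous (fun x => -1 * f x) 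
  by move=> x; apply: cvgM; [exact: cvg_cst|exact: cf].
have := LI _ cNf; rewrite LZ; last exact: compact_ubounded.
by rewrite /I RintegralZl//; [lra|exact: int_nu].
Qed.

End riesz.

(** * Monotone comparison and limits of integrals *)

Lemma le_integral_measurable {d} {T : measurableType d} {R : realType}
    (nu : {measure set T -> \bar R}) (f g : T -> \bar R) :
  measurable_fun setT f -> measurable_fun setT g ->
  (forall x, (f x <= g x)%E) -> (\int[nu]_x f x <= \int[nu]_x g x)%E.
Proof.
(* The parts are compared separately because either integral may be infinite. *)
move=> mf mg fg; rewrite [leLHS]integralE [leRHS]integralE; apply: leeB.
  apply: ge0_le_integral => //; [exact: measurable_funepos..|].
  by move=> x _; rewrite !funeposE ge_max !le_max fg lexx !orbT.
apply: ge0_le_integral => //; [exact: measurable_funeneg..|].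
by move=> x _; rewrite !funenegE ge_max !le_max leeN2 fg lexx !orbT.
Qed.

(** Monotone convergence for the nonnegative differences with [f 0]; the common bound [s] makes the
    limit integrable. It serves for [hlim] and, with opposite signs, for elements of [F]. *)
Lemma nondecreasing_limit_integral {d} {T : measurableType d} {R : realType}
    (nu : {measure set T -> \bar R}) (f : nat -> T -> R) (g : T -> \bar R) (s : R) :
  (forall n, nu.-integrable setT (EFin \o f n)) ->
  (forall x, nondecreasing_seq (fun n => f n x)) ->
  (forall x, (f n x)%:E @[n --> \oo] --> g x) ->
  (forall n, \int[nu]_x f n x <= s) ->
  nu.-integrable setT g /\ (\int[nu]_x g x <= s%:E)%E.
Proof.
move=> intf ndf fg fs.
have mg : measurable_fun setT g.
  apply: (emeasurable_fun_cvg (fun n => EFin \o f n)) => [n|x _]; last exact: fg.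
  exact: measurable_int (intf n).
pose df n (x : T) := (f n x - f 0 x)%:E.
have intdf n : nu.-integrable setT (df n).
  have := integrableB measurableT (intf n) (intf 0).
  by apply: eq_integrable => // x _.
pose dg x := (g x - (f 0 x)%:E)%E.
have dfg x : df n x @[n --> \oo] --> dg x.
  have cst0 : (fun _ : nat => (f 0 x)%:E) @ \oo --> (f 0 x)%:E by exact: cvg_cst.
  by apply: (cvgeB _ (fg x) cst0); rewrite fin_num_adde_defl.
have df0 n x : (0 <= df n x)%E by rewrite lee_fin subr_ge0 ndf.
have dg0 x : (0 <= dg x)%E.
  by apply: (cvge_ge _ (dfg x)); exact: nearW.
have le_dg : (\int[nu]_x dg x <= (s - \int[nu]_x f 0 x)%:E)%E.
  have -> : (\int[nu]_x dg x = \int[nu]_x limn (df^~ x))%E.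
    by apply: eq_integral => x _; apply/esym/cvg_lim.
  apply: (cvge_le _ (cvg_monotone_convergence measurableT _ _ _)) => //; last 2 first.
  - by move=> n; exact: measurable_int (intdf n).
  - by move=> x _ n m nm; rewrite lee_fin lerD2r ndf.
  apply: nearW => n; rewrite /df.
  have := RintegralB measurableT (intf n) (intf 0).
  rewrite -(fineK (integrable_fin_num measurableT (intdf n))) lee_fin.
  by rewrite /Rintegral /df/= => ->; rewrite lerD2r; exact: fs.
have intdg : nu.-integrable setT dg.
  apply/integrableP; split.
    apply: emeasurable_funB => //; exact: measurable_int (intf 0).
  under eq_integral do rewrite gee0_abs//.
  by rewrite (le_lt_trans le_dg)// ltry.
have gE : g = (fun x => dg x + (EFin \o f 0%N) x)%E.
  by apply/funext => x; apply/esym; exact: subeK.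
rewrite gE; split; first exact: integrableD.
rewrite integralD//.
have -> : (\int[nu]_x (EFin \o f 0%N) x = (\int[nu]_x f 0%N x)%:E)%E.
  by rewrite fineK//; exact: integrable_fin_num (intf 0).
by rewrite (le_trans (leeD2r _ le_dg))// -EFinD subrK.
Qed.

(** * Dini's lemma and compactly supported truncations *)

Lemma dini_le {R : realType} {X : ptopologicalType} (h : nat -> X -> R) (phi : X -> R)
    (e : R) :
  compact [set: X] -> (forall i, continuous (h i)) -> continuous phi ->
  (forall x, nonincreasing_seq (fun i => h i x)) ->
  (forall x, (h i x)%:E @[i --> \oo] --> (phi x)%:E) -> 0 < e ->
  exists i, forall x, h i x <= phi x + e.
Proof.
rewrite compact_cover => cX ch cphi hni hphi e0.
pose U i := [set x | h i x - phi x < e].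
have oU i : setT i -> open (U i).
  move=> _; apply: (@open_comp _ _ (fun x => h i x - phi x) [set y | y < e]).
    by move=> x _; apply: continuousB; [exact: ch|exact: cphi].
  exact: open_lt.
have [|D' _ D'U] := cX nat setT U oU.
  move=> x _; have := hphi x => /fine_cvgP[_ /cvgr_lt/(_ (phi x + e))].
  rewrite ltrDl => /(_ e0) [i _ /(_ i (leqnn i))/= hi].
  by exists i => //; rewrite /U/= ltrBlDl.
exists (\max_(i <- finmap.enum_fset D') i)%N => x.
have [i /= iD' /ltW] := D'U x I.
by rewrite lerBlDl; apply: le_trans; apply: hni; exact: leq_bigmax_seq.
Qed.

(** Subtracting [e] moves the support into the set where [h >= e], which is compact and disjoint
    from the zeros of [H]; the positive part of [h] itself need not have compact support there. *)
Lemma truncation_extCc {R : realType} {X : pmetricType R} (H : set (X -> R))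
    (h : X -> R) (e : R) :
  compact [set: X] -> H h -> continuous h -> 0 < e ->
  extCc H (fun x => Num.max (h x - e) 0).
Proof.
move=> cX Hh ch e0; pose phi (x : X) : R := Num.max (h x - e) 0; rewrite -/phi.
pose A := ~` zeros H.
pose f := sigL A phi.
have cval : continuous (set_val : set_type A -> X) by exact: initial_continuous.
exists f; last first.
  have -> : 'valL_(0 : R) f = patch (fun=> 0) A phi by rewrite -sigLK.
  apply/funext => x; rewrite /patch; case: ifPn => // /negP.
  rewrite inE => /contrapT/(_ _ Hh) hx.
  by rewrite /phi hx sub0r; apply/esym/max_idPr; rewrite oppr_le0 ltW.
split.
  move=> y; apply: (@continuous_comp _ _ _ set_val phi); first exact: cval.
  apply: (@continuous_max R X (fun x => h x - e) (fun=> 0)).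
    by apply: continuousB; [exact: ch|exact: cvg_cst].
  exact: cvg_cst.
pose K := [set x | e <= h x].
have clK : closed K by apply: (preimage_closed _ (@closed_ge R e)) => x _; exact: ch.
have cK : compact K by rewrite -(setTI K); exact: compact_closedI.
have KA : K `<=` A.
  by move=> x; rewrite /K/= => + Zx; rewrite (Zx _ Hh) leNgt e0.
apply: (@subclosed_compact _ _ (set_val @^-1` K)).
- exact: closed_closure.
(* The image of the filter in [X] clusters at a point of [K], which lies in [A] and so lifts to the
   subtype. *)
- move=> F FF FK.
  have [p [Kp clp]] : K `&` cluster (set_val @ F) !=set0 by exact: cK.
  pose q : set_type A := exist _ p (mem_set (KA _ Kp)).
  exists q; split => // B V FB.
  rewrite nbhsE => -[W [[W' oW' W'W] Wq] WV].
  have FB' : F (set_val @^-1` (set_val @` B)) by apply: filterS FB => z Bz; exists z.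
  have [] := clp (set_val @` B) W' FB'.
    by apply: open_nbhs_nbhs; split => //; rewrite -W'W in Wq.
  move=> _ [[y By <-] W'y]; exists y; split => //; apply: WV.
  by rewrite -W'W.
- rewrite closureE => y; apply; split.
    by apply: (preimage_closed _ clK) => z _; exact: cval.
  move=> z /=; rewrite /f /sigL/= /phi /Num.max; case: ltP => [_|].
    by rewrite eqxx.
  by rewrite subr_ge0.
Qed.

(** * Integrals of elements of [F], and superadditivity of [S_mu] *)

Section duality.
Context {R : realType} {X : pmetricType R}.
Hypothesis compactX : compact [set: X].
Variable H : set (X -> R).
Hypothesis H_continuous : forall h, H h -> continuous h.
Hypothesis H_subspace : submod_closed (mem H).
Hypothesis H_total : total_outside_zeros H.
Variable F : set (X -> \bar R).
Hypothesis F_cone : cone F.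
Hypothesis F_admissible : admissible H F.

Local Notation borel_measure := {measure set (borelType X) -> \bar R}.

Let H0 : H (fun=> 0).
Proof. by have := H_subspace.1; rewrite inE. Qed.

Let HD a f g : H f -> H g -> H (fun x => a * f x + g x).
Proof.
move=> Hf Hg; have := H_subspace.2 a f g; rewrite !inE; exact.
Qed.

(** Carries inequalities from [H] to [F]: the functions of [H] decreasing to [u] all lie above it,
    so their integrals are at least [r], and monotone convergence applies to their negatives. *)
Lemma admissible_integral_ge (nu : borel_measure) u r :
  (nu setT < +oo)%E -> F u ->
  (forall k, H k -> (forall x, (u x <= (k x)%:E)%E) -> r <= \int[nu]_x k x) ->
  nu.-integrable setT u /\ (r%:E <= \int[nu]_x u x)%E.
Proof.
move=> nuT Fu ru; have [k [Hk ku]] := F_admissible.2 _ Fu.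
have intk n : nu.-integrable setT (EFin \o k n).
  by apply: continuous_integrable => //; exact: H_continuous.
have [|x n m nm|x|n|intNu leNu] := @nondecreasing_limit_integral _ (borelType X) R nu
    (fun n x => - k n x) (fun x => - u x)%E (- r).
- move=> n; have := integrableN (intk n).
  by apply: eq_integrable => // x _.
- by rewrite lerN2; apply: (ku x).1.
- have := cvgeN (ku x).2; exact.
- have -> : \int[nu]_x (- k n x) = - \int[nu]_x k n x.
    rewrite -mulN1r -RintegralZl//; congr Rintegral.
    by apply/funext => x; rewrite mulN1r.
  rewrite lerN2; apply: ru => [//|x].
  apply: (cvge_le _ (ku x).2); exists n => // m /= nm.
  by rewrite lee_fin; apply: (ku x).1.
have intu : nu.-integrable setT u.
  have := integrableN intNu.
  by apply: eq_integrable => // x _ /=; rewrite oppeK.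
split => //; move: leNu; rewrite integralN ?EFinN ?leeN2//.
exact: integrable_add_def.
Qed.

Lemma admissible_measurable u : F u -> measurable_fun setT (u : borelType X -> \bar R).
Proof.
move=> Fu; have [k [Hk ku]] := F_admissible.2 _ Fu.
apply: (@emeasurable_fun_cvg _ (borelType X) R setT (fun n => EFin \o k n)) => [n|x _];
  last exact: (ku x).2.
by apply/measurable_EFinP; apply: continuous_borel_measurable; exact: H_continuous.
Qed.

Lemma le_integral_admissible (nu : borel_measure) u k : F u -> H k ->
  (nu setT < +oo)%E -> (forall x, (u x <= (k x)%:E)%E) ->
  (\int[nu]_x u x <= (\int[nu]_x k x)%:E)%E.
Proof.
move=> Fu Hk nuT uk.
have intk : nu.-integrable setT (EFin \o k).
  by apply: continuous_integrable => //; exact: H_continuous.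
rewrite fineK; last exact: integrable_fin_num intk.
apply: le_integral_measurable => //; first exact: admissible_measurable.
exact: measurable_int intk.
Qed.

Variable mu : borel_measure.
Hypothesis muT : (mu setT < +oo)%E.

(** A finite lower bound on the integral of [u] also bounds the integrals of all elements of [H]
    above [u]. Integrability is what lets integrals add in [minorantD]. *)
Let mu_integrable u r : F u -> (r%:E <= \int[mu]_x u x)%E -> mu.-integrable setT u.
Proof.
move=> Fu ru; apply: (admissible_integral_ge (r := r) muT Fu _).1 => k Hk uk.
by rewrite -lee_fin (le_trans ru)//; exact: le_integral_admissible.
Qed.

(* [minorant k r] expresses [r <= S_mu k], or rather that the supremum
   defining [S_mu k] has a term which is at least [r]. *)
Definition minorant (k : X -> R) (r : R) : Prop :=
  exists u, [/\ F u, forall x, (u x <= (k x)%:E)%E & (r%:E <= \int[mu]_x u x)%E].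

Lemma minorantD k k' r r' : minorant k r -> minorant k' r' ->
  minorant (fun x => k x + k' x) (r + r').
Proof.
move=> [u [Fu uk ru]] [u' [Fu' u'k' ru']]; exists (u \+ u')%E; split.
- exact: F_cone.1.
- by move=> x; rewrite EFinD leeD.
- rewrite integralD//; [|exact: mu_integrable ru|exact: mu_integrable ru'].
  by rewrite EFinD leeD.
Qed.

Lemma minorantZ c k r : 0 < c -> minorant k r -> minorant (fun x => c * k x) (c * r).
Proof.
move=> c0 [u [Fu uk ru]]; exists (fun x => c%:E * u x)%E; split.
- exact: F_cone.2.
- by move=> x; rewrite EFinM lee_pmul2l// lte_fin.
- rewrite integralZl//; last exact: mu_integrable ru.
  by rewrite EFinM lee_pmul2l// lte_fin.
Qed.

Lemma le_minorant k k' r r' : (forall x, k x <= k' x) -> r' <= r ->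
  minorant k r -> minorant k' r'.
Proof.
move=> kk' r'r [u [Fu uk ru]]; exists u; split => //.
- by move=> x; rewrite (le_trans (uk x))// lee_fin.
- by rewrite (le_trans _ ru)// lee_fin.
Qed.

Lemma minorant0_le r : minorant (fun=> 0) r -> r <= 0.
Proof.
move=> [u [Fu u0 ru]]; have := le_trans ru (le_integral_admissible Fu H0 muT u0).
by rewrite lee_fin Rintegral_cst// mul0r.
Qed.

(** * Lower bounds on [S_mu] from the constant [C] *)

Variable C : R.
Hypothesis C0 : 0 < C.
Hypothesis mu_bound : forall h, H h -> exists u, [/\ F u,
  forall x, (u x <= (h x)%:E)%E &
  ((- (C * sup_norm h))%:E <= \int[mu]_x u x)%E].

Lemma minorant_bound h M : H h -> (forall x, `|h x| <= M) -> minorant h (- (C * M)).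
Proof.
move=> Hh hM; apply: (@le_minorant h _ (- (C * sup_norm h))) => //.
  rewrite lerN2 ler_pM2l//; apply: ge_sup; first by exists `|h point|; exists point.
  by move=> _ [x _ <-].
by have [u [Fu uh hu]] := mu_bound Hh; exists u.
Qed.

(* Apply the bound on [S_mu] to [h / n <= h] and let [n] go to infinity. *)
Lemma minorant_ge0 h e : H h -> (forall x, 0 <= h x) -> 0 < e -> minorant h (- e).
Proof.
move=> Hh h0 e0.
have [M hM] := compact_ubounded compactX (H_continuous Hh).
have M0 : 0 <= M by rewrite (le_trans _ (hM point)).
pose c := e / (C * M + e).
have d0 : 0 < C * M + e by rewrite ltr_wpDl// mulr_ge0// ltW.
have c0 : 0 < c by rewrite divr_gt0.
have := minorantZ c0 (minorant_bound Hh hM); apply: le_minorant.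
  move=> x; rewrite ler_piMl// /c ler_pdivrMr// mul1r lerDr mulr_ge0//.
  exact: ltW.
by rewrite mulrN lerN2 /c mulrAC ler_pdivrMr// ler_pM2l// lerDl ltW.
Qed.

Let H_lin2 a b f g : H f -> H g -> H (fun x => a * f x + b * g x).
Proof.
move=> Hf Hg; have := HD a Hf (HD b Hg H0).
by under eq_fun do rewrite addr0.
Qed.

(** Totality gives a sequence decreasing to the truncation, and Dini's lemma makes one term
    uniformly close. *)
Let approx_truncation h e : H h -> 0 < e -> exists p, [/\ H p,
  forall x, Num.max (h x - e) 0 <= p x & forall x, p x <= Num.max (h x - e) 0 + e].
Proof.
move=> Hh e0.
have phiH := truncation_extCc compactX Hh (H_continuous Hh) e0.
have [k [Hk kphi]] := H_total phiH.
have [|||i ki] := @dini_le R X k _ e compactX _ _ _ (fun x => (kphi x).2) e0.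
- by move=> i; exact: H_continuous.
- move=> x; apply: (@continuous_max R X (fun x => h x - e) (fun=> 0)).
    by apply: continuousB; [exact: H_continuous|exact: cvg_cst].
  exact: cvg_cst.
- by move=> x; exact: (kphi x).1.
exists (k i); split => // x; rewrite -lee_fin.
apply: (cvge_le _ (kphi x).2); exists i => // m /= im.
by rewrite lee_fin; apply: (kphi x).1.
Qed.

(* Up to [5 e], [h] is the difference of [p ~ h^+] and [q ~ h^-]. *)
Lemma minorant_lower_bound h M e : H h -> 0 <= M -> (forall x, - M <= h x) ->
  0 < e -> minorant h (- (C * M) - e).
Proof.
move=> Hh M0 hM e0.
(* The losses are [d] for [p], [C * (M + d)] for [- q] and [C * (3 * d)] for the remainder; their
   sum is at most [C * M + e]. *)
pose d := e / (5 * C + 1).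
have C51 : 0 < 5 * C + 1.
  by rewrite ltr_wpDl// mulr_ge0// ltW.
have d0 : 0 < d by rewrite divr_gt0.
have Cd : 0 <= C * d by rewrite mulr_ge0// ltW.
have dE : 5 * (C * d) + d = e.
  by rewrite /d; field; rewrite gt_eqF.
clearbody d.
have HNh : H (fun x => -1 * h x + 0) by exact: HD.
have [p [Hp p1 p2]] := approx_truncation Hh d0.
have [q [Hq q1 q2]] := approx_truncation HNh d0.
have p0 x : 0 <= p x by rewrite (le_trans _ (p1 x))// le_max lexx orbT.
(* Being nonnegative, [p] costs only [d] however large [h] is above; only [q], of size at most
   [M + d], brings in [C * M]. *)
have mp := minorant_ge0 Hp p0 d0.
have HNq : H (fun x => -1 * q x + 0) by exact: HD.
have mq : minorant (fun x => -1 * q x + 0) (- (C * (M + d))).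
  apply: minorant_bound => // x; have := q1 x; have := q2 x; rewrite /Num.max ler_norml.
  by have := hM x; case: ltP => ? ? ? ?; apply/andP; split; lra.
have Hr : H (fun x => 1 * h x + 1 * (-1 * p x + q x)) by apply: H_lin2 => //; exact: HD.
have mr : minorant (fun x => 1 * h x + 1 * (-1 * p x + q x)) (- (C * (3 * d))).
  apply: minorant_bound => // x.
  have := q1 x; have := q2 x; have := p1 x; have := p2 x; rewrite /Num.max ler_norml.
  by case: ltP => ?; case: ltP => ? ? ? ? ?; apply/andP; split; lra.
have := minorantD (minorantD mp mq) mr; apply: le_minorant => [x|]; first by lra.
lra.
Qed.

(** * The Hahn-Banach functional and its measure *)

Variables (h : nat -> X -> R) (s : R).
Hypothesis Hh : forall i, H (h i).
Hypothesis h_nd : forall x, nondecreasing_seq (fun i => h i x).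
Hypothesis hs : forall i r, minorant (h i) r -> r <= s.

(* The upper bounds on [L f] forced on a positive linear [L] of norm at most
   [C] by [L k >= S_mu k] for [k] in [H] and by [L (h j) <= s] for all [j]. *)
Let upper_bounds (f : X -> R) : set R := [set v | exists c t j k r,
  [/\ 0 <= c, 0 <= t, H k, forall x, f x <= c + k x &
      minorant (fun x => t * h j x - k x) r /\ v = C * c + t * s - r]].

Let minorant_h_le t j r : 0 <= t -> minorant (fun x => t * h j x) r -> r <= t * s.
Proof.
rewrite le_eqVlt => /predU1P[<-|t0 m].
  under eq_fun do rewrite mul0r.
  by rewrite mul0r; exact: minorant0_le.
have ti0 : 0 < t^-1 by rewrite invr_gt0.
rewrite -ler_pdivrMl//; apply: (@hs j); have := minorantZ ti0 m.
by apply: le_minorant => // x; rewrite mulrA mulVf ?mul1r// gt_eqF.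
Qed.

(** Both [h j] and [h j'] lie below the term of index [maxn j j'], so the sum again involves a
    single term of the sequence. *)
Let upper_boundsD f g v w : upper_bounds f v -> upper_bounds g w ->
  upper_bounds (fun x => f x + g x) (v + w).
Proof.
move=> [c [t [j [k [r [c0 t0 Hk fk [m ->]]]]]]].
move=> [c' [t' [j' [k' [r' [c'0 t'0 Hk' gk' [m' ->]]]]]]].
exists (c + c'), (t + t'), (maxn j j'), (fun x => 1 * k x + 1 * k' x), (r + r').
split; [exact: addr_ge0|exact: addr_ge0|exact: H_lin2| |split; last lra].
  by move=> x; have := fk x; have := gk' x; lra.
have := minorantD m m'; apply: le_minorant => // x.
have := ler_wpM2l t0 (h_nd x (leq_maxl j j')).
have := ler_wpM2l t'0 (h_nd x (leq_maxr j j')).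
by rewrite mulrDl; lra.
Qed.

Let upper_boundsZ a f v : 0 < a -> upper_bounds f v ->
  upper_bounds (fun x => a * f x) (a * v).
Proof.
move=> a0 [c [t [j [k [r [c0 t0 Hk fk [m ->]]]]]]].
exists (a * c), (a * t), j, (fun x => a * k x + 0), (a * r).
have a0' := ltW a0.
split; [exact: mulr_ge0|exact: mulr_ge0|exact: HD| |split; last lra].
  by move=> x; have := ler_wpM2l a0' (fk x); lra.
by have := minorantZ a0 m; apply: le_minorant => // x; lra.
Qed.

Let minorant00 : minorant (fun=> 0) 0.
Proof.
have := @minorant_bound _ 0 H0; rewrite mulr0 oppr0; apply => x.
by rewrite normr0.
Qed.

Let upper_bounds_cst f M : 0 <= M -> (forall x, f x <= M) -> upper_bounds f (C * M).
Proof.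
move=> M0 fM; exists M, 0, 0%N, (fun=> 0), 0; split => //.
  by move=> x; rewrite addr0.
split; last lra.
by have := minorant00; apply: le_minorant => // x; lra.
Qed.

(** As [k >= - (M + c)], it has a minorant of integral at least [- (C * (M + c)) - e]. Adding it to
    the one of [t * h j - k] cancels [k], and what remains is at most [t * s]. The one-sided bound
    is essential: nothing bounds [k] from above. *)
Let upper_bounds_ge f M v : 0 <= M -> (forall x, - M <= f x) -> upper_bounds f v ->
  - (C * M) <= v.
Proof.
move=> M0 fM [c [t [j [k [r [c0 t0 Hk fk [m ->]]]]]]].
have {}fk x : - (M + c) <= k x by have := fM x; have := fk x; lra.
apply/ler_addgt0Pr => e e0.
have /(minorantD m) := minorant_lower_bound Hk (addr_ge0 M0 c0) fk e0.
under [X in minorant X]eq_fun do rewrite subrK.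
by move=> /(minorant_h_le t0); lra.
Qed.

Lemma dominating_functional : exists L : (X -> R) -> R,
  [/\ forall a f g, ubounded f -> ubounded g ->
        L (fun x => a * f x + g x) = a * L f + L g,
      forall f g, ubounded f -> ubounded g -> (forall x, f x <= g x) -> L f <= L g,
      forall j, L (h j) <= s &
      forall k r, H k -> minorant k r -> r <= L k].
Proof.
have ub_lin (a : R) (f g : X -> R) :
    ubounded f -> ubounded g -> ubounded (a *: f + g).
  move=> [M fM] [N gN]; exists (`|a| * M + N) => x.
  by rewrite (le_trans (ler_normD _ _))// lerD// normrM ler_wpM2l.
have ub0 : ubounded (0 : X -> R) by exists 0 => x; rewrite normr0.
have lb f : ubounded f -> has_lbound (upper_bounds f).
  move=> [M fM]; have M0 : 0 <= M by rewrite (le_trans _ (fM point)).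
  exists (- (C * M)) => v; apply: upper_bounds_ge => // x.
  by have := fM x; rewrite ler_norml => /andP[].
have ne f : ubounded f -> upper_bounds f !=set0.
  move=> [M fM]; have M0 : 0 <= M by rewrite (le_trans _ (fM point)).
  by exists (C * M); apply: upper_bounds_cst => // x; rewrite (le_trans (ler_norm _)).
pose p f := inf (upper_bounds f).
have pge f v : ubounded f -> upper_bounds f v -> p f <= v.
  by move=> bf fv; apply: ge_inf => //; exact: lb.
have sp : sublinear_on ubounded p.
  split=> [f g bf bg|c f].
    rewrite -lerBlDr; apply: lb_le_inf; first exact: ne.
    move=> v fv; rewrite lerBlDr [leRHS]addrC -lerBlDr; apply: lb_le_inf; first exact: ne.
    move=> w gw; rewrite lerBlDr [leRHS]addrC; apply: pge; last exact: upper_boundsD.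
    by rewrite -[f]scale1r; exact: ub_lin.
  rewrite le_eqVlt => /predU1P[<- bf|c0 bf].
    rewrite mul0r scale0r; apply: pge => //.
    by rewrite -(mulr0 C); exact: upper_bounds_cst.
  rewrite -ler_pdivrMl//; apply: lb_le_inf; first exact: ne.
  move=> v fv; rewrite ler_pdivrMl//; apply: pge; last exact: upper_boundsZ.
  by rewrite -[_ *: _]addr0; exact: ub_lin.
have [L [L_lin Lp]] := hahn_banach ub_lin ub0 sp.
have bh k : H k -> ubounded k.
  by move=> Hk; apply: compact_ubounded => //; exact: H_continuous.
exists L; split.
- exact: L_lin.
- move=> f g bf bg fg.
  (* Since [f - g <= 0], the constant [c = 0] already gives the upper bound [0]. *)
  have := L_lin (-1) g f bg bf; have := Lp _ (ub_lin (-1) g f bg bf).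
  suff : p (-1 *: g + f) <= 0 by lra.
  apply: pge; first exact: ub_lin.
  rewrite -(mulr0 C); apply: upper_bounds_cst => // x.
  by rewrite -[X in X <= _]/(-1 * g x + f x); have := fg x; lra.
- move=> j; apply: (le_trans (Lp _ (bh _ (Hh j)))); apply: pge; first exact: bh.
  (* With [t = 1] and [k = h j] the difference vanishes and the bound is [s]. *)
  exists 0, 1, j, (h j), 0; split => //; first by move=> x; rewrite add0r.
  split; last lra.
  by have := minorant00; apply: le_minorant => // x; lra.
- move=> k r Hk mk.
  have := L_lin (-1) k 0 (bh _ Hk) ub0.
  have := Lp _ (ub_lin (-1) k 0 (bh _ Hk) ub0).
  have L0 : L 0 = 0.
    by have := L_lin 1 0 0 ub0 ub0; rewrite scale1r addr0; lra.
  suff : p (-1 *: k + 0) <= - r by rewrite L0; lra.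
  apply: pge; first by apply: ub_lin => //; exact: bh.
  (* With [t = 0] and [- k] in place of [k], the minorant of [k] bounds [L (- k)] by [- r]. *)
  exists 0, 0, 0%N, (fun x => -1 * k x + 0), r; split => //; first exact: HD.
    by move=> x; rewrite add0r.
  split; last lra.
  by apply: le_minorant mk => // x; lra.
Qed.

Lemma dominated_measure : exists nu : borel_measure,
  [/\ radon nu, (nu setT < +oo)%E, measure_le F nu mu & forall j, \int[nu]_x h j x <= s].
Proof.
have [L [L_lin L_le Lh Lk]] := dominating_functional.
have [nu [radon_nu nuT nuL]] := riesz_compact compactX L_lin L_le.
exists nu; split => //; last by move=> j; rewrite nuL//; exact: H_continuous.
(* For a real value the inequalities on [H] pass to [u]; [-oo] is trivial, and [+oo] is excluded
   since [u] lies below [k 0]. *)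
move=> u Fu; case E : (\int[mu]_x u x)%E => [r| |]; last by rewrite leNye.
  apply: (admissible_integral_ge nuT Fu _).2 => k Hk uk.
  rewrite nuL; last exact: H_continuous.
  by apply: Lk => //; exists u; rewrite E.
have [k [Hk ku]] := F_admissible.2 _ Fu.
have := @le_integral_admissible mu u (k 0%N) Fu (Hk 0%N) muT.
rewrite E leye_eq => abs; suff : false by [].
apply: abs => x; apply: (cvge_le _ (ku x).2); apply: nearW => m.
by rewrite lee_fin; apply: (ku x).1.
Qed.

End duality.

(** * The two inequalities between [Smu] and [Imu] *)

Theorem theorem5p2 (R : realType) (X : pmetricType R)
    (compactX : compact [set: X])
    (H : set (X -> R))
    (H_continuous : forall h, H h -> continuous h)
    (H_subspace : submod_closed (mem H))
    (H_total : total_outside_zeros H)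
    (F : set (X -> \bar R))
    (F_usc : F `<=` usc)
    (F_cone : cone F)
    (F_admissible : admissible H F)
    (mu : {measure set (borelType X) -> \bar R})
    (mu_radon : radon mu)
    (mu_bound : exists2 C : R, 0 < C &
       forall h, H h -> exists u, [/\ F u,
         forall x, (u x <= (h x)%:E)%E &
         ((- (C * sup_norm h))%:E <= \int[mu]_x u x)%E]) :
  forall (h : nat -> X -> R) (hlim : X -> \bar R),
    (forall i, H (h i)) ->
    increases_to h hlim ->
    Smu F mu hlim = Imu F mu hlim.
Proof.
move=> h hlim Hh hhlim; have [C C0 bound] := mu_bound.
have muT : (mu setT < +oo)%E by exact: mu_radon.1.
have le_hlim i x : ((h i x)%:E <= hlim x)%E.
  apply: (cvge_ge _ (hhlim x).2); exists i => // n /= ni.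
  by rewrite lee_fin; apply: (hhlim x).1.
have mh n : measurable_fun setT (EFin \o h n : borelType X -> \bar R).
  apply/measurable_EFinP; apply: continuous_borel_measurable.
  exact: H_continuous.
have mhlim : measurable_fun setT (hlim : borelType X -> \bar R).
  by apply: (@emeasurable_fun_cvg _ (borelType X) R setT (fun n => EFin \o h n)) => // x _;
    exact: (hhlim x).2.
apply/eqP; rewrite eq_le; apply/andP; split.
  apply: ge_ereal_sup => _ [u [Fu uhlim] <-].
  apply: le_ereal_inf_tmp => _ [nu [_ numu] <-].
  rewrite (le_trans (numu u Fu))//; apply: le_integral_measurable => //.
  exact: admissible_measurable F_admissible _ Fu.
(* A minorant of [h 0] lies below [hlim] and excludes [-oo]; at [+oo] nothing remains to prove, so
   the value is a real [s]. *)
have SmuNy : (-oo < Smu F mu hlim)%E.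
  have [u [Fu uh hu]] := bound _ (Hh 0%N).
  apply: (@lt_le_trans _ _ (\int[mu]_x u x)%E).
    by rewrite (lt_le_trans _ hu)// ltNyr.
  by apply: ereal_sup_ubound; exists u => //; split => // x; exact: le_trans (uh x) _.
case E : (Smu F mu hlim) => [s| |]; [|by rewrite leey|by rewrite E in SmuNy].
have [] := @dominated_measure R X compactX H H_continuous H_subspace H_total F
  F_cone F_admissible mu muT C C0 bound h s Hh (fun x => (hhlim x).1).
  (* A minorant of [h i] is also one of [hlim], so it competes in the supremum [s]. *)
  move=> i r [u [Fu uh ru]]; rewrite -lee_fin (le_trans ru)// -E.
  by apply: ereal_sup_ubound; exists u => //; split => // x; exact: le_trans (uh x) _.
move=> nu [radon_nu nuT numu nuh].
apply: (@le_trans _ _ (\int[nu]_x hlim x)%E).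
  by apply: ereal_inf_lbound; exists nu.
apply: (@nondecreasing_limit_integral _ (borelType X) R nu h hlim s _ _ _ nuh).2.
- by move=> n; apply: continuous_integrable => //; exact: H_continuous.
- by move=> x; exact: (hhlim x).1.
- by move=> x; exact: (hhlim x).2.
Qed.
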